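(* Let $(J,\mathcal{B})$ be a set-algebra and let $\varphi:\mathcal{B}\to\mathbb{R}$ be a bounded submodular setfunction. Then $\varphi$ has bounded variation.
   Context: A set-algebra $(J,\mathcal{B})$ is a family $\mathcal{B}$ of subsets of $J$ containing $\emptyset$ and $J$ and closed under complements and finite unions. A setfunction $\varphi:\mathcal{B}\to\mathbb{R}$ is submodular if $\varphi(X\cup Y)+\varphi(X\cap Y)\le\varphi(X)+\varphi(Y)$ for all $X,Y\in\mathcal{B}$. It has bounded variation if there is $K\in\mathbb{R}$ such that $\sum_{i=1}^n|\varphi(X_i)-\varphi(X_{i-1})|\le K$ for every chain $\emptyset=X_0\subseteq X_1\subseteq\dots\subseteq X_n=J$ of sets $X_i\in\mathcal{B}$. *)

(* Defs.v *)
From HB Require Import structures.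
From mathcomp Require Import all_boot all_order all_algebra.
From mathcomp Require Import boolp classical_sets reals topology normedtype.
From mathcomp Require Import measure.

Set Implicit Arguments.
Unset Strict Implicit.
Unset Printing Implicit Defensive.

Import Order.TTheory GRing.Theory Num.Theory.
Import numFieldNormedType.Exports.

Local Open Scope classical_set_scope.
Local Open Scope ring_scope.

(* The library's algebraOfSetsType requires a pointed carrier, which would
   exclude an empty J; hence an unbundled predicate on an arbitrary type. *)
Definition set_algebra (J : Type) (B : set (set J)) : Prop :=
  [/\ B set0, B setT, setC_closed B & setU_closed B].

(* In the definitions below a setfunction on B is a total function on set J of
   which only the values on B are ever used. *)
Definition submodular_on (R : realType) (J : Type) (B : set (set J))
    (phi : set J -> R) : Prop :=
  forall X Y, B X -> B Y -> phi (X `|` Y) + phi (X `&` Y) <= phi X + phi Y.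

(* Only X 0, ..., X n matter. *)
Definition full_chain (J : Type) (B : set (set J)) (n : nat)
    (X : nat -> set J) : Prop :=
  [/\ X 0%N = set0, X n = setT,
      forall i, (i <= n)%N -> B (X i) &
      forall i, (i < n)%N -> X i `<=` X i.+1].

Definition bounded_variation_on (R : realType) (J : Type) (B : set (set J))
    (phi : set J -> R) : Prop :=
  exists K : R, forall (n : nat) (X : nat -> set J), full_chain B n X ->
    \sum_(0 <= i < n) `|phi (X i.+1) - phi (X i)| <= K.

(* Main.v *)
(** Along a chain [X 0, X 1, ...] collect into one set [Y] the differences
    [X i.+1 `\` X i] of the steps on which [phi] increases, and put
    [Y i := Y `&` X i].  Submodularity applied to [X i] and [Y i.+1] shows that
    [phi] increases at least as much from [Y i] to [Y i.+1] as from [X i] to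
    [X i.+1], so the positive variation along the chain is at most
    [phi Y - phi set0], which is bounded; the total variation is twice the
    positive variation minus [phi setT - phi set0]. *)
Require Import Defs.
From mathcomp Require Import all_boot all_order all_algebra.
From mathcomp Require Import boolp classical_sets reals topology normedtype.
From mathcomp Require Import lra.
Import Order.TTheory GRing.Theory Num.Theory.
Import numFieldNormedType.Exports.

Local Open Scope classical_set_scope.
Local Open Scope ring_scope.

Lemma set_algebraD (J : Type) (B : set (set J)) (X Y : set J) :
  set_algebra B -> B X -> B Y -> B (X `\` Y).
Proof.
move=> [_ _ BC BU] BX BY.
have -> : X `\` Y = ~` (~` X `|` Y) by rewrite setCU setCK setDE.
by apply: (BC); apply: BU => //; apply: BC.
Qed.

(** The sets [X] and [Y ∪ (X' \ X)] have union [X'] and intersection [Y]. *)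
Lemma submodular_increment (R : realType) (J : Type) (B : set (set J))
    (phi : set J -> R) (X X' Y : set J) :
  set_algebra B -> submodular_on B phi -> B X -> B X' -> B Y ->
  X `<=` X' -> Y `<=` X ->
  phi X' - phi X <= phi (Y `|` (X' `\` X)) - phi Y.
Proof.
move=> algB submod BX BX' BY XX' YX.
have [_ _ _ BU] := algB.
have BXX' := set_algebraD _ _ _ _ algB BX' BX.
have := submod X (Y `|` (X' `\` X)) BX (BU _ _ BY BXX').
have -> : X `|` (Y `|` (X' `\` X)) = X' by rewrite setUA (setUidl YX) setDUK.
have -> : X `&` (Y `|` (X' `\` X)) = Y by rewrite setIUr setDIK setU0 setIidr.
lra.
Qed.

(** The chain may end at any [X n], so that induction on [n] applies; [Y ⊆ X n] is what the next
    increment needs. *)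
Lemma chain_variation_le (R : realType) (J : Type) (B : set (set J))
    (phi : set J -> R) (X : nat -> set J) (n : nat) :
  set_algebra B -> submodular_on B phi -> X 0%N = set0 ->
  (forall i, (i <= n)%N -> B (X i)) ->
  (forall i, (i < n)%N -> X i `<=` X i.+1) ->
  exists Y, [/\ B Y, Y `<=` X n &
    \sum_(0 <= i < n) `|phi (X i.+1) - phi (X i)|
      <= 2 * (phi Y - phi set0) - (phi (X n) - phi set0)].
Proof.
move=> algB submod X0; elim: n => [|n IHn] BX XS.
  exists set0; rewrite X0 big_nil; split => //; last by lra.
  by case: algB.
have [||Y [BY YX leY]] := IHn.
- by move=> i /leqW; exact: BX.
- by move=> i /ltnW; exact: XS.
have {}XS := XS n (ltnSn n); have BX' := BX _ (leqnn n.+1).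
have {}BX := BX _ (leqnSn n).
rewrite big_nat_recr //=.
have [dgt0|dle0] := ltP 0 (phi (X n.+1) - phi (X n)).
- exists (Y `|` (X n.+1 `\` X n)); split.
  + by have [_ _ _] := algB; apply => //; exact: set_algebraD.
  + by move=> x [/YX /XS|[]].
  + have := submodular_increment _ _ _ _ _ _ _ algB submod BX BX' BY XS YX.
    rewrite gtr0_norm //; lra.
(* The added absolute value is exactly the drop of [phi (X n)] in the bound. *)
- exists Y; split => //; first exact: subset_trans XS.
  rewrite ler0_norm //; lra.
Qed.

Theorem theorem2p6 (R : realType) (J : Type) (B : set (set J))
    (phi : set J -> R) (algB : set_algebra B)
    (bnd : [bounded phi X | X in B]) (submod : submodular_on B phi) :
  bounded_variation_on B phi.
Proof.
have [M [_ /(_ (M + 1))]] := bnd.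
rewrite ltrDl ltr01 => /(_ isT) leM.
have [B0 BT _ _] := algB.
(* [M + 1] bounds [|phi|] on [B], and 6 = 2 + 2 + 1 + 1 adds up the coefficients in [leY]. *)
exists (6 * (M + 1)) => n X [X0 XT BX XS].
have [Y [BY _ leY]] := chain_variation_le _ _ _ _ _ _ algB submod X0 BX XS.
apply: le_trans leY _; rewrite XT.
have /ler_normlP[] := leM Y BY.
have /ler_normlP[] := leM set0 B0.
have /ler_normlP[] := leM setT BT.
lra.
Qed.
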